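(* There is a randomized $O(\log^2 m\,\log mn)$-competitive online algorithm for CCFL (capacity-constrained facility location), where $m$ is the number of facilities and $n$ the number of clients. That is, the expected value of the sum of opening costs, assignment costs and makespan of the algorithm's (integral) solution is at most $O(\log^2m\,\log mn)$ times the optimal offline value.
   Context: CCFL: there are $m$ potential facility locations, facility $i$ having opening cost $c_i\ge 0$ and capacity $u_i$, given up-front (the capacities play no role in the objective below). There are $n$ clients which arrive online; client $j$ has, for each facility $i\in[m]$, an assignment cost $a_{ij}\ge0$ and a demand/load $p_{ij}\ge0$, revealed on its arrival. The online algorithm must (irrevocably) open facilities, paying the opening costs, and assign each arriving client $j$ to some open facility $i$, paying $a_{ij}$ and incurring load $p_{ij}$ on $i$. The makespan of an assignment is the maximum total load on any facility. The objective is to minimize the sum of opening costs, assignment costs and the makespan. The $O(\cdot)$ hides an absolute constant; logarithms inside are read as bounded below by a positive constant. Competitiveness of a randomized algorithm is in expectation, for an input sequence fixed in advance. *)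

(* Defs.v *)
From HB Require Import structures.
From mathcomp Require Import all_boot all_order all_algebra.
From mathcomp Require Import all_classical all_reals all_analysis.

Set Implicit Arguments.
Unset Strict Implicit.
Unset Printing Implicit Defensive.

Import Order.TTheory GRing.Theory Num.Theory.

Local Open Scope classical_set_scope.
Local Open Scope ring_scope.

(* The data of an instance of capacity-constrained facility location that is
   known up-front. The number of clients is not part of it. *)
Record facilities (R : realType) := Facilities {
  num_fac : nat;
  num_fac_gt0 : (0 < num_fac)%N;
  opening_cost : 'I_num_fac -> R;
  capacity : 'I_num_fac -> R;
  opening_cost_ge0 : forall i, 0 <= opening_cost i }.

Record client (R : realType) (m : nat) := Client {
  assign_cost : 'I_m -> R;
  demand : 'I_m -> R;
  assign_cost_ge0 : forall i, 0 <= assign_cost i;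
  demand_ge0 : forall i, 0 <= demand i }.

Section Solutions.
Variables (R : realType) (F : facilities R) (n : nat).
Variable sigma : n.-tuple (client R (num_fac F)).
Implicit Types (X : {set 'I_(num_fac F)}) (f : {ffun 'I_n -> 'I_(num_fac F)}).

Definition feasible X f : bool := [forall j, f j \in X].

Definition load f (i : 'I_(num_fac F)) : R :=
  \sum_(j < n | f j == i) demand (tnth sigma j) i.

(* Loads are nonnegative, so the default value 0 does not affect the maximum. *)
Definition makespan f : R := \big[Num.max/0]_(i < num_fac F) load f i.

Definition cost X f : R :=
  \sum_(i in X) opening_cost i
  + \sum_(j < n) assign_cost (tnth sigma j) (f j)
  + makespan f.

(* The infimum is over a finite nonempty set, so it is attained. *)
Definition opt : R :=
  inf [set z : R | exists X f, feasible X f /\ z = cost X f].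

End Solutions.

(* [opened h] is the set of facilities that are open once the clients of [h]
   (in order of arrival) have been served; [assigned h c] is the facility
   chosen for the client [c] arriving after [h]. Both depend on the clients
   revealed so far only, not on the future clients nor on their number.
   Monotonicity of [opened] is the irrevocability of openings; assignments are
   irrevocable because each of them is made once, on arrival. *)
Record online_alg (R : realType) (F : facilities R) := OnlineAlg {
  opened : seq (client R (num_fac F)) -> {set 'I_(num_fac F)};
  assigned : seq (client R (num_fac F)) -> client R (num_fac F) ->
             'I_(num_fac F);
  opened_mono : forall h c, opened h \subset opened (rcons h c);
  assigned_opened : forall h c, assigned h c \in opened (rcons h c) }.

(* A probability distribution over deterministic online algorithms; the
   decision made after each history is a (discrete) random variable. *)
Record rand_online_alg (R : realType) (F : facilities R) := RandOnlineAlg {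
  seed_display : measure_display;
  seed : measurableType seed_display;
  seed_prob : probability seed R;
  strategy : seed -> online_alg F;
  measurable_opened : forall h X,
    measurable [set w : seed | opened (strategy w) h = X];
  measurable_assigned : forall h c i,
    measurable [set w : seed | assigned (strategy w) h c = i] }.

Arguments strategy {R F} r _.

Definition online_assignment (R : realType) (F : facilities R)
    (A : online_alg F) (n : nat) (sigma : n.-tuple (client R (num_fac F))) :
    {ffun 'I_n -> 'I_(num_fac F)} :=
  [ffun j : 'I_n => assigned A (take j sigma) (tnth sigma j)].

Definition online_cost (R : realType) (F : facilities R)
    (A : online_alg F) (n : nat) (sigma : n.-tuple (client R (num_fac F))) : R :=
  cost sigma (opened A sigma) (online_assignment A sigma).

Definition expected_cost (R : realType) (F : facilities R)
    (A : rand_online_alg F) (n : nat)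
    (sigma : n.-tuple (client R (num_fac F))) : \bar R :=
  ('E_(seed_prob A)[fun w => online_cost (strategy A w) sigma])%E.

Definition log_ge1 (R : realType) (k : nat) : R := Num.max 1 (ln k%:R).

(* The algorithm may depend on the up-front data [F], and on nothing else. *)
Definition competitive (R : realType) (A : forall F : facilities R, rand_online_alg F)
    (ratio : nat -> nat -> R) : Prop :=
  forall (F : facilities R) (n : nat) (sigma : n.-tuple (client R (num_fac F))),
    (expected_cost (A F) sigma <= (ratio (num_fac F) n * opt sigma)%:E)%E.

(* Main.v *)
Require Import Defs.
From HB Require Import structures.
From mathcomp Require Import all_boot all_order all_algebra.
From mathcomp Require Import all_classical all_reals all_analysis.
From mathcomp Require Import ring lra.

Import Order.TTheory GRing.Theory Num.Theory.

Local Open Scope ring_scope.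

Set Implicit Arguments.
Unset Strict Implicit.
Unset Printing Implicit Defensive.

(* Guess and double: keep a guess g with opt <= g <= 2 opt for the clients seen
   so far, and start a new phase (all levels y_i back to 1/m) whenever the
   optimum overtakes g.

   Within a phase every facility i has a level y_i. A client raises a price
   alpha until the facilities affordable at that price have total level
   sum min(1, y_i) >= 1; meanwhile y_i grows at rate y_i / c'_i, where
   c'_i = c_i + g/m. The price at which i becomes affordable is its assignment
   cost plus the congestion charge c'_i max(1, y_i) p_i / (20 g). A set T
   of affordable facilities of total level between 1 and 2 then serves the client,
   and the levels in T are multiplied by 1 + p_i / (20 g). Each client thus increases
   the potential sum c'_i y_i by O(alpha), while the facility used by the
   optimum can only stay unaffordable or below level 1 for a total price of
   O(c'_i log m) plus its own charges. The factor 1/20 absorbs the resulting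
   circularity, so all prices of a phase add up to O(g log m). The load that T
   puts on i is O(g log (m y_i)) = O(g log m), even if every member of every T
   received the full client.

   Rounding: facility i has one uniform threshold w_i in {0, .., m-1}, drawn once
   and for all. The k-th client goes to some i in T with w_i < m b_k y_i, where
   b_k = 1 + 2 ln (k + 1); by independence there is none with probability at
   most exp(- b_k) <= 1 / (k + 1)^2, and then the client goes to a facility whose
   opening cost, assignment cost and demand are at most g. Only the opening costs
   lose the factor b_n = O(log (m n)). The seed space is finite, hence coded in
   nat as a sum of Dirac masses. *)

(** * Elementary estimates and two finite combinatorial facts *)

Section Reals.
Context {R : realType}.
Implicit Types x y : R.

Lemma ln1D_ge_half x : 0 <= x <= 1 -> x / 2 <= ln (1 + x).
Proof.
move=> /andP[x0 x1].
have h1 : 1 - x / 2 <= expR (- (x / 2)).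
  by apply: le_trans (expR_ge1Dx _); lra.
have h2 : expR (x / 2) * expR (- (x / 2)) = 1 by rewrite -expRD subrr expR0.
have h3 := expR_gt0 (x / 2).
rewrite -ler_expR lnK ?posrE; last by lra.
nra.
Qed.

Lemma ln2_le1 : ln 2 <= 1 :> R.
Proof.
rewrite (_ : 2 = 1 + 1); last by lra.
by apply: le_ln1Dx; lra.
Qed.

Lemma bernoulli x n : 0 <= x -> 1 + n%:R * x <= (1 + x) ^+ n.
Proof.
move=> x0; elim: n => [|n IH]; first by rewrite mul0r addr0 expr0.
rewrite exprSr -natr1.
have n0 : 0 <= n%:R :> R by [].
nra.
Qed.

(** With [d] at most every positive value, rounding up to a multiple of [d] at most doubles it, and
    0 stays 0. This discretizes the rising price: at time [t] it equals [d * t], and [b i] is the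
    time at which [i] becomes affordable. *)
Lemma relative_grid (I : finType) (g : I -> R) (d0 : R) :
  0 < d0 -> (forall i, 0 <= g i) ->
  exists d : R, exists b : I -> nat,
    [/\ 0 < d, d <= d0 & forall i, g i <= d * (b i)%:R <= 2 * g i].
Proof.
move=> d00 g0.
pose d := \big[Num.min/d0]_(i | 0 < g i) g i.
have dpos : 0 < d by exact: lt_bigmin.
exists d, (fun i => if g i == 0 then 0%N else (Num.truncn (g i / d)).+1).
split=> // [|i]; first exact: bigmin_le_id.
case: eqVneq => [->|gn0]; first by rewrite !mulr0 lexx.
have gi : 0 < g i by rewrite lt_neqAle eq_sym gn0 g0.
have dg : d <= g i by apply: bigmin_le_cond.
have /andP[h1 h2] : (Num.truncn (g i / d))%:R <= g i / d < (Num.truncn (g i / d)).+1%:R.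
  by apply: truncn_itv; rewrite divr_ge0 // ltW.
apply/andP; split.
  by rewrite mulrC -ler_pdivrMr // ltW.
move: h1; rewrite ler_pdivlMr // -natr1 => h1; nra.
Qed.

(** Elements are dropped one by one: each is worth at most 1, so a sum above 2 cannot jump below
    1. *)
Lemma subset_sum_between (I : finType) (f : I -> R) (A : {set I}) :
  (forall i, 0 <= f i <= 1) -> 1 <= \sum_(i in A) f i ->
  exists2 T : {set I}, T \subset A & 1 <= \sum_(i in T) f i <= 2.
Proof.
move=> f01; have [k] := ubnP #|A|; elim: k A => // k IH A /ltnSE Ak A1.
have [A2|A2] := leP (\sum_(i in A) f i) 2.
  by exists A => //; rewrite A1 A2.
have [i iA] : exists i, i \in A.
  by apply/set0Pn/eqP => A0; move: A1; rewrite A0 big_set0; lra.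
have := A2; rewrite (big_setD1 i iA) /= => A2'.
have cA : (#|A :\ i| < k)%N.
  by apply: leq_trans Ak; rewrite [X in (_ < X)%N](cardsD1 i) iA.
have sA : 1 <= \sum_(j in A :\ i) f j by have := f01 i; lra.
have [T TA T12] := IH _ cA sA.
exists T; last exact: T12.
exact: fintype.subset_trans TA (subD1set _ _).
Qed.

End Reals.

(** * Serving one client *)

Section Step.
Context {R : realType} {m : nat} (c : 'I_m -> R).
Hypothesis m_gt0 : (0 < m)%N.
Hypothesis c_ge0 : forall i, 0 <= c i.
Implicit Types (lam al : R) (y : 'I_m -> R) (q : client R m).

Definition eligible lam q i := (c i <= lam) && (demand q i <= lam).

Definition reg_cost lam i := c i + lam / m%:R.

Definition price lam y q i :=
  assign_cost q i
  + reg_cost lam i * (demand q i / lam) * Num.max 1 (y i) / 20.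

(* A client that can afford a facility of level 1 is served at once, so waiting
   never lifts a level above 2: this caps the total charge to a facility. *)
Definition ln_cap (x : R) := ln (Num.min x 2).

(** What the analysis retains of one arrival: [al] is the final price and [y] becomes [y'].
    [served_psi] bounds the potential by the price; [served_opt] bounds the price through any
    eligible facility, in particular the one used by the optimum. *)
Record served lam y q (T : {set 'I_m}) al y' : Prop := Served {
  served_elig : forall i, i \in T -> eligible lam q i;
  served_cover : 1 <= \sum_(i in T) Num.min 1 (y' i);
  served_ge0 : 0 <= al;
  served_assign : forall i, i \in T -> assign_cost q i <= al;
  served_mono : forall i, y i <= y' i;
  served_psi : \sum_(i | c i <= lam) reg_cost lam i * y' i <=
               \sum_(i | c i <= lam) reg_cost lam i * y i + 5 * al;
  served_load : forall i, i \in T ->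
    y i * (1 + demand q i / lam / 20) <= y' i;
  served_opt : forall i, eligible lam q i ->
    al <= 2 * price lam y q i
          + 2 * (reg_cost lam i * (ln_cap (y' i) - ln_cap (y i))) }.

Lemma ln_cap_le x z : 0 < x -> x <= z -> ln_cap x <= ln_cap z.
Proof.
move=> x0 xz; rewrite /ln_cap ler_ln ?posrE ?lt_min ?x0 ?(lt_le_trans x0 xz) //=.
by rewrite le_min !ge_min xz lexx !orbT.
Qed.

(** The price rises in steps of [d] up to the first time [k] of sufficient cover. From time [b i]
    on, each step multiplies the level of an eligible [i] by [r i]; at the end the members of [T]
    get the congestion factor [u i]. *)
Lemma serve_exists lam y q : 0 < lam -> (forall i, 0 < y i) ->
  (exists i, eligible lam q i) -> exists T al y', served lam y q T al y'.
Proof.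
move=> lam0 y0 [i0 i0E].
have mR : 0 < m%:R :> R by rewrite ltr0n.
have dm0 : 0 < lam / m%:R by rewrite divr_gt0.
have cc0 i : 0 < reg_cost lam i by rewrite ltr_wpDl.
have cc1 i : lam / m%:R <= reg_cost lam i by rewrite lerDr.
have ld0 i : 0 <= demand q i / lam by rewrite divr_ge0 ?demand_ge0 // ltW.
have mx1 i : 1 <= Num.max 1 (y i) by rewrite le_max lexx.
have mxy i : y i <= Num.max 1 (y i) by rewrite le_max lexx orbT.
have pr0 i : 0 <= price lam y q i.
  apply: addr_ge0; first exact: assign_cost_ge0.
  rewrite divr_ge0 // mulr_ge0 //; last by have := mx1 i; lra.
  by rewrite mulr_ge0 // ltW.
(* The bound on [d] keeps [r i] at most 2: one step at most doubles a level, and [ln (r i)] is at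
   least half of [d / reg_cost lam i]. *)
have [d [b [d0 dle bP]]] := relative_grid dm0 pr0.
pose r i := 1 + d / reg_cost lam i.
have dc i : 0 < d / reg_cost lam i <= 1.
  by rewrite divr_gt0 //= ler_pdivrMr // mul1r (le_trans dle).
pose z t i : R := if eligible lam q i then y i * r i ^+ (t - b i) else y i.
have r1 i : 1 <= r i by rewrite /r; have := dc i; lra.
have z0 t i : 0 < z t i.
  rewrite /z; case: ifP => // _; rewrite mulr_gt0 // exprn_gt0 //.
  by have := r1 i; lra.
have yz t i : y i <= z t i.
  by rewrite /z; case: ifP => // _; rewrite ler_peMr ?exprn_ege1 // ltW.
have zS t i : eligible lam q i -> (b i <= t)%N -> z t.+1 i = z t i * r i.
  by move=> E bt; rewrite /z E subSn // exprSr mulrA.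
have zN t i : ~~ (eligible lam q i && (b i <= t)%N) -> z t.+1 i = z t i.
  rewrite /z; case: ifP => //= _; rewrite -ltnNge => tb.
  have /eqP -> : (t.+1 - b i == 0)%N by rewrite subn_eq0.
  have /eqP -> : (t - b i == 0)%N by rewrite subn_eq0 ltnW.
  by [].
pose act t : {set 'I_m} := [set i | eligible lam q i && (b i <= t)%N].
have actE t i : (i \in act t) = eligible lam q i && (b i <= t)%N by rewrite inE.
pose P t := 1 <= \sum_(i in act t) Num.min 1 (z t i).
have min0 t i : 0 <= Num.min 1 (z t i) by rewrite le_min ler01 ltW.
have Pex : exists t, P t.
  (* By Bernoulli's inequality the level of [i0] gains at least [x] per step, so about [x^-1] steps
     after time [b i0] it covers the client alone. *)
  set x := d / reg_cost lam i0 * y i0.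
  have x0 : 0 < x by rewrite mulr_gt0 //; have := dc i0; lra.
  exists (b i0 + Num.truncn x^-1).+1.
  rewrite /P (bigD1 i0) /=; last by rewrite inE i0E /= leqW // leq_addr.
  rewrite -[X in X <= _]addr0 lerD ?sumr_ge0 // le_min lexx /=.
  rewrite /z i0E -addnS addKn.
  apply: (@le_trans _ _ (y i0 * (1 + (Num.truncn x^-1).+1%:R * (d / reg_cost lam i0)))).
    have xV : 0 <= x^-1 by rewrite invr_ge0 ltW.
    have /andP[_ /ltW h] := truncn_itv xV.
    have : x^-1 * x <= (Num.truncn x^-1).+1%:R * x by rewrite ler_wpM2r // ltW.
    by rewrite mulVf ?gt_eqF // /x; have := y0 i0; nra.
  rewrite ler_wpM2l ?(ltW (y0 _)) // bernoulli //.
  by have := dc i0; lra.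
pose k := ex_minn Pex.
have Pk : P k by rewrite /k; case: ex_minnP.
have NP t : (t < k)%N -> \sum_(i in act t) Num.min 1 (z t i) < 1.
  rewrite /k; case: ex_minnP => k' _ kmin tk; rewrite ltNge; apply/negP => Pt.
  by have := kmin _ Pt; rewrite leqNgt tk.
have zlt t i : (t < k)%N -> i \in act t -> z t i < 1.
  move=> tk ia; have := NP _ tk; rewrite (bigD1 i ia) /=.
  have : 0 <= \sum_(j in act t | j != i) Num.min 1 (z t j) by apply: sumr_ge0.
  move=> h1 h2; have : Num.min 1 (z t i) < 1 by lra.
  by rewrite gt_min ltxx.
have cov01 i : 0 <= Num.min 1 (z k i) <= 1 by rewrite min0 ge_min lexx.
have [T Tact T12] := subset_sum_between cov01 Pk.
have TE i : i \in T -> eligible lam q i /\ (b i <= k)%N.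
  by move=> /(fintype.subsetP Tact); rewrite inE => /andP[].
pose u i : R := if i \in T then 1 + demand q i / lam / 20 else 1.
have u1 i : 1 <= u i by rewrite /u; case: ifP => // _; have := ld0 i; lra.
have pral i : (b i <= k)%N -> price lam y q i <= d * k%:R.
  move=> bk; have /andP[h _] := bP i; apply: le_trans h _.
  by rewrite ler_wpM2l ?ler_nat // ltW.
have apr i : assign_cost q i <= price lam y q i.
  rewrite lerDl divr_ge0 // mulr_ge0 //; last by have := mx1 i; lra.
  by rewrite mulr_ge0 // ltW.
have zuz i : z k i <= z k i * u i by rewrite ler_peMr // ltW.
(* One step before [k] the active level is still below 1, and the last step at most doubles it. *)
have z2 i : eligible lam q i -> (b i < k)%N -> z k i <= 2.
  move=> E bk; have -> : k = k.-1.+1 by rewrite prednK // (leq_ltn_trans _ bk).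
  have k1 : (k.-1 < k)%N by rewrite prednK // (leq_ltn_trans _ bk).
  have bk1 : (b i <= k.-1)%N by rewrite -ltnS prednK // (leq_ltn_trans _ bk).
  rewrite zS //.
  have := zlt _ i k1; rewrite inE E bk1 => /(_ isT); have := z0 k.-1 i.
  rewrite /r; have := dc i; nra.
have zmax i : eligible lam q i -> z k i <= 2 * Num.max 1 (y i).
  move=> E; have [bk|kb] := ltnP (b i) k.
    by apply: le_trans (z2 _ E bk) _; have := mx1 i; lra.
  rewrite /z E (eqP (_ : k - b i == 0)%N) ?subn_eq0 // mulr1.
  by have := mx1 i; have := mxy i; lra.
exists T, (d * k%:R), (fun i => z k i * u i); split.
- by move=> i /TE[].
- have /andP[h _] := T12; apply: le_trans h _; apply: ler_sum => i _.
  by rewrite le_min !ge_min zuz lexx !orbT.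
- by rewrite mulr_ge0 // ltW.
- by move=> i /TE[_ bk]; apply: le_trans (apr i) (pral _ bk).
- by move=> i; apply: le_trans (yz k i) (zuz i).
(* A step adds [d * z t i] for each active [i], and before time [k] the active levels sum to less
   than 1. *)
- have grow t : (t <= k)%N ->
      \sum_(i | c i <= lam) reg_cost lam i * z t i <=
      \sum_(i | c i <= lam) reg_cost lam i * y i + d * t%:R.
    elim: t => [|t IH] tk.
      rewrite mulr0 addr0; apply: ler_sum => i _.
      by rewrite /z sub0n mulr1; case: ifP.
    have := IH (ltnW tk); rewrite -natr1 mulrDr mulr1 addrA => {}IH.
    have step : \sum_(i | c i <= lam) reg_cost lam i * z t.+1 i =
        \sum_(i | c i <= lam) reg_cost lam i * z t i
        + \sum_(i in act t) d * z t i.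
      rewrite [X in _ + X](_ : _ = \sum_(i | c i <= lam)
          (if i \in act t then d * z t i else 0)); last first.
        rewrite -big_mkcondr; apply: eq_bigl => i; rewrite inE.
        by rewrite /eligible; case: (c i <= lam).
      rewrite -big_split /=; apply: eq_bigr => i _; rewrite inE.
      case: ifP => [/andP[E bt]|/negbT nE]; last by rewrite zN // addr0.
      rewrite zS // /r; field.
      by rewrite gt_eqF.
    rewrite step; apply: lerD IH _.
    rewrite -mulr_sumr -[leRHS]mulr1 ler_wpM2l ?(ltW d0) //.
    apply: le_trans (ltW (NP _ tk)); apply: ler_sum => i ia.
    by rewrite le_min lexx ltW // zlt.
  have eqT : \sum_(i | c i <= lam) reg_cost lam i * (z k i * u i) =
      \sum_(i | c i <= lam) reg_cost lam i * z k i
      + \sum_(i in T) reg_cost lam i * z k i * (demand q i / lam / 20).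
    rewrite [X in _ + X](_ : _ = \sum_(i | c i <= lam)
        (if i \in T then reg_cost lam i * z k i * (demand q i / lam / 20)
         else 0)); last first.
      rewrite -big_mkcondr; apply: eq_bigl => i.
      case iT: (i \in T); last by rewrite andbF.
      by have [/andP[-> _] _] := TE _ iT.
    rewrite -big_split /=; apply: eq_bigr => i _; rewrite /u.
    by case: ifP => _; ring.
  rewrite eqT.
  (* The congestion charge of each [i] in [T] is at most the price [d * k]. One factor 2 comes from
     [zmax], the other from the total capped level of [T]. *)
  have h4 : \sum_(i in T) reg_cost lam i * z k i * (demand q i / lam / 20)
      <= 4 * (d * k%:R).
    have /andP[_ T2] := T12.
    apply: (@le_trans _ _ (\sum_(i in T) 2 * (d * k%:R) * Num.min 1 (z k i))).
      apply: ler_sum => i /TE[E bk].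
      set M := Num.max 1 (y i).
      have pk := pral _ bk.
      have xM : reg_cost lam i * (demand q i / lam) * M / 20 <= d * k%:R.
        apply: le_trans pk; rewrite lerDr; exact: assign_cost_ge0.
      have M1 : 1 <= M := mx1 i.
      have zM : z k i <= 2 * M * Num.min 1 (z k i).
        have [h|h] := leP 1 (z k i); first by rewrite mulr1 zmax.
        have := z0 k i; nra.
      set X := reg_cost lam i * (demand q i / lam) in xM *.
      have X0 : 0 <= X by rewrite mulr_ge0 // ltW.
      have mn := min0 k i.
      have e1 : X * z k i <= X * (2 * M * Num.min 1 (z k i)) by rewrite ler_wpM2l.
      have e2 : (X * M / 20) * Num.min 1 (z k i) <= (d * k%:R) * Num.min 1 (z k i).
        by rewrite ler_wpM2r.
      rewrite (_ : reg_cost lam i * z k i * (demand q i / lam / 20)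
          = X * z k i / 20); last by rewrite /X; ring.
      lra.
    rewrite -mulr_sumr; have : 0 <= d * k%:R by rewrite mulr_ge0 // ltW.
    by nra.
  by have := grow k (leqnn _); lra.
- by move=> i iT; rewrite /u iT ler_wpM2r //; have := ld0 i; lra.
- move=> i E.
  (* If [k <= b i], twice the price of [i] dominates [al]. Otherwise the time after [b i] is paid
     for by the growth of the logarithm of its level, which by [z2] the cap at 2 does not cut. *)
  have [bk|kb] := ltnP (b i) k; last first.
    have h1 : d * k%:R <= d * (b i)%:R by rewrite ler_wpM2l ?ler_nat // ltW.
    have /andP[_ h2] := bP i.
    have h3 : 0 <= ln_cap (z k i * u i) - ln_cap (y i).
      by rewrite subr_ge0 ln_cap_le // (le_trans (yz k i)).
    have h4 := mulr_ge0 (ltW (cc0 i)) h3.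
    lra.
  have kE : d * k%:R = d * (b i)%:R + d * (k - b i)%:R.
    by rewrite -mulrDr -natrD subnKC // ltnW.
  have /andP[_ h2] := bP i.
  rewrite kE lerD //.
  have zk2 := z2 _ E bk.
  have h3 : ln (z k i) <= ln_cap (z k i * u i).
    rewrite /ln_cap ler_ln ?posrE ?lt_min ?z0 ?le_min ?zuz ?zk2 //.
    by rewrite mulr_gt0 //=; have := u1 i; lra.
  have h5 : ln_cap (y i) <= ln (y i).
    by rewrite /ln_cap ler_ln ?posrE ?lt_min ?y0 ?ge_min ?lexx //=.
  have h6 : ln (z k i) = ln (y i) + ln (r i) *+ (k - b i).
    rewrite /z E lnM ?posrE ?lnXn ?exprn_gt0 //; by have := r1 i; lra.
  have h7 : d / reg_cost lam i / 2 <= ln (r i).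
    by rewrite /r ln1D_ge_half //; have := dc i; lra.
  have h8 : d <= 2 * (reg_cost lam i * ln (r i)).
    have := ler_wpM2l (ltW (cc0 i)) h7.
    rewrite (_ : reg_cost lam i * (d / reg_cost lam i / 2) = d / 2); first by lra.
    by field; rewrite gt_eqF.
  have h9 : d * (k - b i)%:R <= 2 * (reg_cost lam i * (ln (r i) *+ (k - b i))).
    rewrite -(mulr_natr (ln _)).
    have n0 : 0 <= (k - b i)%:R :> R by [].
    have := ler_wpM2r n0 h8; lra.
  have h10 : reg_cost lam i * (ln (r i) *+ (k - b i)) <=
     reg_cost lam i * (ln_cap (z k i * u i) - ln_cap (y i)).
    by rewrite ler_wpM2l ?(ltW (cc0 i)) //; lra.
  lra.
Qed.

End Step.

(** * One phase with a fixed guess *)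

Section Phase.
Context {R : realType} {m : nat} (c : 'I_m -> R).
Hypothesis m_gt0 : (0 < m)%N.
Hypothesis c_ge0 : forall i, 0 <= c i.
Implicit Types (lam al A : R) (y L : 'I_m -> R) (q : client R m).
Implicit Types (s : seq (client R m)) (X : {set 'I_m}).
Implicit Types (t : seq (client R m * 'I_m)).

(** [A] and [L] accumulate prices and loads on top of the values [A0] and [L0] inherited from
    earlier phases. A client counts with its full demand on every member of [T]. *)
Inductive phase lam A0 L0 : seq (client R m) -> ('I_m -> R) -> R ->
    ('I_m -> R) -> Prop :=
| phase_nil : phase lam A0 L0 [::] (fun=> m%:R^-1) A0 L0
| phase_rcons s y A L q T al y' :
    phase lam A0 L0 s y A L -> served c lam y q T al y' ->
    phase lam A0 L0 (rcons s q) y' (A + al)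
      (fun i => L i + if i \in T then demand q i else 0).

Definition trace_load t i : R := \sum_(e <- t | e.2 == i) demand e.1 i.

Definition trace_assign t : R := \sum_(e <- t) assign_cost e.1 e.2.

(** Bounding the three cost components separately lets a plan for the whole history be restricted to
    the clients of one phase. *)
Record plan lam X t : Prop := Plan {
  plan_mem : all (fun e => e.2 \in X) t;
  plan_opening : \sum_(i in X) c i <= lam;
  plan_assign : trace_assign t <= lam;
  plan_load : forall i, trace_load t i <= lam }.

Lemma trace_load_ge0 t i : 0 <= trace_load t i.
Proof. by apply: sumr_ge0 => e _; exact: demand_ge0. Qed.

Lemma trace_assign_ge0 t : 0 <= trace_assign t.
Proof. by apply: sumr_ge0 => e _; exact: assign_cost_ge0. Qed.

Lemma trace_load_cat t1 t2 i :
  trace_load (t1 ++ t2) i = trace_load t1 i + trace_load t2 i.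
Proof. by rewrite /trace_load big_cat. Qed.

Lemma trace_assign_cat t1 t2 :
  trace_assign (t1 ++ t2) = trace_assign t1 + trace_assign t2.
Proof. by rewrite /trace_assign big_cat. Qed.

Lemma trace_load_seq1 e i :
  trace_load [:: e] i = if e.2 == i then demand e.1 i else 0.
Proof. by rewrite /trace_load big_mkcond big_seq1. Qed.

Lemma trace_assign_seq1 e : trace_assign [:: e] = assign_cost e.1 e.2.
Proof. by rewrite /trace_assign big_seq1. Qed.

Lemma plan_cat lam X t1 t2 :
  plan lam X (t1 ++ t2) -> plan lam X t1 /\ plan lam X t2.
Proof.
case; rewrite all_cat trace_assign_cat => /andP[X1 X2] cX aX lX.
have := trace_assign_ge0 t1; have := trace_assign_ge0 t2 => a2 a1.
split; split=> //; try lra.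
- move=> i; have := lX i; rewrite trace_load_cat.
  by have := trace_load_ge0 t2 i; lra.
- move=> i; have := lX i; rewrite trace_load_cat.
  by have := trace_load_ge0 t1 i; lra.
Qed.

Lemma plan_seq1 lam X e : plan lam X [:: e] ->
  [/\ e.2 \in X, eligible c lam e.1 e.2 & assign_cost e.1 e.2 <= lam].
Proof.
case; rewrite /= andbT trace_assign_seq1 => eX cX aX lX; split=> //.
apply/andP; split; last by have := lX e.2; rewrite trace_load_seq1 eqxx.
apply: le_trans cX; rewrite (bigD1 e.2 eX) /= lerDl.
by apply: sumr_ge0.
Qed.

Lemma sum_trace (g : 'I_m -> R) X t : all (fun e => e.2 \in X) t ->
  \sum_(e <- t) g e.2 * demand e.1 e.2 = \sum_(i in X) g i * trace_load t i.
Proof.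
elim: t => [_|e t IH /= /andP[eX tX]].
  by rewrite big_nil big1 // => i _; rewrite /trace_load big_nil mulr0.
rewrite big_cons IH // (bigD1 e.2 eX) /= [in RHS](bigD1 e.2 eX) /=.
rewrite addrA; congr (_ + _).
  by rewrite /trace_load big_cons eqxx mulrDr.
apply: eq_bigr => i /andP[_ ie].
by rewrite /trace_load big_cons eq_sym (negbTE ie).
Qed.

(** [served_opt] is summed along the plan: the logarithms telescope from the initial level 1/m, and
    by monotonicity the congestion charges may be taken at the final levels. For the loads, each
    service by [i] raises [ln (y i)] by at least [demand q i / (40 * lam)]. *)
Lemma phase_invariant lam A0 L0 s y A L X t : 0 < lam ->
  phase lam A0 L0 s y A L -> unzip1 t = s -> plan lam X t ->
  [/\ forall i, m%:R^-1 <= y i,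
      \sum_(i | c i <= lam) reg_cost c lam i * y i <=
        \sum_(i | c i <= lam) reg_cost c lam i / m%:R + 5 * (A - A0),
      A - A0 <= 2 * trace_assign t
        + \sum_(e <- t) reg_cost c lam e.2 * Num.max 1 (y e.2)
            * demand e.1 e.2 / lam / 10
        + 2 * \sum_(i in X) reg_cost c lam i * (ln_cap (y i) + ln m%:R),
      forall i, L i - L0 i <= 40 * lam * (ln (y i) + ln m%:R) &
      forall i, lam < c i -> L i = L0 i].
Proof.
move=> lam0 ph; have mR : 0 < m%:R :> R by rewrite ltr0n.
have mV : 0 < m%:R^-1 :> R by rewrite invr_gt0.
have rc0 i : 0 <= reg_cost c lam i by rewrite addr_ge0 // divr_ge0 // ltW.
have m1 : 1 <= m%:R :> R by rewrite ler1n.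
elim: ph t => [|{}s {}y {}A {}L q T al y' ph IH sv] t.
  case: t => // _ _; split=> //.
  - by rewrite subrr mulr0 addr0.
  - rewrite subrr /trace_assign !big_nil mulr0 !add0r mulr_ge0 //.
    apply: sumr_ge0 => i _; rewrite mulr_ge0 //.
    rewrite /ln_cap (min_idPl _); first by rewrite lnV ?posrE // addNr.
    by rewrite (@le_trans _ _ 1) ?invf_le1 // ler1n.
  - by move=> i; rewrite subrr lnV ?posrE // addNr mulr0.
case/lastP: t => [/(congr1 size)|t e]; first by rewrite size_rcons.
rewrite /unzip1 map_rcons => /rcons_inj[ts eq] pl.
have [pt /plan_seq1[eX eE _]] : plan lam X t /\ plan lam X [:: e].
  by apply: plan_cat; rewrite cats1.
have [h1 h2 h3 h4 h5] := IH t ts pt.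
have y0 i : 0 < y i by apply: lt_le_trans (h1 i).
have mono := served_mono sv.
have y'0 i : 0 < y' i by apply: lt_le_trans (mono i).
split.
- by move=> i; apply: le_trans (h1 i) (mono i).
- have := served_psi sv; lra.
- rewrite -cats1 trace_assign_cat trace_assign_seq1 big_cat /= big_seq1 eq.
  rewrite eq in eE.
  have opt := served_opt sv eE.
  have e1 : \sum_(e <- t) reg_cost c lam e.2 * Num.max 1 (y e.2)
            * demand e.1 e.2 / lam / 10 <=
    \sum_(e <- t) reg_cost c lam e.2 * Num.max 1 (y' e.2)
            * demand e.1 e.2 / lam / 10.
    apply: ler_sum => e' _; rewrite !ler_wpM2r ?invr_ge0 ?(ltW lam0) //.
      exact: demand_ge0.
    by rewrite ler_wpM2l // ge_max !le_max lexx mono orbT.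
  have e2 : reg_cost c lam e.2 * Num.max 1 (y e.2) * demand q e.2 / lam / 10 <=
    reg_cost c lam e.2 * Num.max 1 (y' e.2) * demand q e.2 / lam / 10.
    rewrite !ler_wpM2r ?invr_ge0 ?(ltW lam0) //.
      exact: demand_ge0.
    by rewrite ler_wpM2l // ge_max !le_max lexx mono orbT.
  have e3 : \sum_(i in X) reg_cost c lam i * (ln_cap (y i) + ln m%:R)
      + reg_cost c lam e.2 * (ln_cap (y' e.2) - ln_cap (y e.2)) <=
     \sum_(i in X) reg_cost c lam i * (ln_cap (y' i) + ln m%:R).
    rewrite !(bigD1 e.2 eX) /=.
    have : \sum_(i in X | i != e.2) reg_cost c lam i * (ln_cap (y i) + ln m%:R)
      <= \sum_(i in X | i != e.2) reg_cost c lam i * (ln_cap (y' i) + ln m%:R).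
      by apply: ler_sum => i _; rewrite ler_wpM2l // lerD2r ln_cap_le.
    lra.
  have e4 : 2 * price c lam y q e.2 = 2 * assign_cost q e.2 +
    reg_cost c lam e.2 * Num.max 1 (y e.2) * demand q e.2 / lam / 10.
    by rewrite /price; field; rewrite gt_eqF.
  lra.
- move=> i; case: ifP => iT; last first.
    rewrite addr0; apply: le_trans (h4 i) _.
    by rewrite ler_wpM2l ?lerD2r ?ler_ln ?posrE ?mono // mulr_ge0 // ltW.
  have /andP[ci di] := served_elig sv iT.
  have d0 := demand_ge0 q i.
  have dl : 0 <= demand q i / lam / 20 <= 1.
    rewrite !divr_ge0 ?(ltW lam0) //= ler_pdivrMr // ler_pdivrMr //; nra.
  have g1 := ln1D_ge_half dl.
  have g2 : ln (y i) + ln (1 + demand q i / lam / 20) <= ln (y' i).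
    rewrite -lnM ?posrE ?ler_ln ?posrE ?mulr_gt0 ?(served_load sv) //; lra.
  have g3 : demand q i = 40 * lam * (demand q i / lam / 20 / 2).
    by field; rewrite gt_eqF.
  have := h4 i; nra.
- move=> i ci; rewrite h5 //; case: ifP => iT; last by rewrite addr0.
  by have /andP[] := served_elig sv iT; rewrite leNgt ci.
Qed.

(** The constant is 40 * 67, from the load bound, the largest of the three in [phase_bounds]. *)
Definition phase_factor : R := 2680 * (1 + ln m%:R).

(** Potential and price bound each other: [Psi] is at most [2 * lam + 5 * (A - A0)], while the
    congestion charges contribute [Psi / 10] to [A - A0]. The net coefficient 1/2 of [A - A0] is
    absorbed on the left. *)
Lemma phase_bounds lam A0 L0 s y A L X t : 0 < lam ->
  phase lam A0 L0 s y A L -> unzip1 t = s -> plan lam X t ->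
  [/\ A <= A0 + phase_factor * lam,
      \sum_(i | c i <= lam) c i * y i <= phase_factor * lam &
      forall i, L i <= L0 i + phase_factor * lam].
Proof.
move=> lam0 ph ts pl; rewrite /phase_factor.
have [h1 h2 h3 h4 h5] := phase_invariant lam0 ph ts pl.
case: (pl) => pm po pa plo.
have mR : 0 < m%:R :> R by rewrite ltr0n.
have mV : 0 < m%:R^-1 :> R by rewrite invr_gt0.
have m1 : 1 <= m%:R :> R by rewrite ler1n.
have rc0 i : 0 <= reg_cost c lam i by rewrite addr_ge0 // divr_ge0 // ltW.
have lm0 : 0 <= ln m%:R :> R by rewrite ln_ge0.
set l := 1 + ln m%:R.
have l1 : 1 <= l by rewrite lerDl.
have y0 i : 0 < y i by apply: lt_le_trans (h1 i).
set Psi := \sum_(i | c i <= lam) reg_cost c lam i * y i in h2.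
have cX i : i \in X -> c i <= lam.
  move=> iX; apply: le_trans po; rewrite (bigD1 i iX) /= lerDl.
  by apply: sumr_ge0.
have cardm (P : pred 'I_m) : \sum_(i | P i) lam / m%:R <= lam.
  rewrite sumr_const -(mulr_natr (lam / _)) mulrAC ler_pdivrMr //.
  rewrite ler_wpM2l ?(ltW lam0) // ler_nat -[leqRHS]card_ord.
  exact: max_card.
have init : \sum_(i | c i <= lam) reg_cost c lam i / m%:R <= 2 * lam.
  apply: (@le_trans _ _ (\sum_(i | c i <= lam) 2 * (lam / m%:R))); last first.
    by rewrite -mulr_sumr ler_wpM2l.
  apply: ler_sum => i ci; rewrite mulrA ler_wpM2r ?(ltW mV) //.
  have : lam / m%:R <= lam by rewrite ler_pdivrMr //; nra.
  rewrite /reg_cost; lra.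
have SX : \sum_(i in X) reg_cost c lam i <= 2 * lam.
  by rewrite big_split /=; have := cardm (mem X); lra.
have SXy : \sum_(i in X) reg_cost c lam i * y i <= Psi.
  rewrite /Psi big_mkcond [leRHS]big_mkcond; apply: ler_sum => i _.
  case: ifP => iX; first by rewrite cX.
  by case: ifP => // _; rewrite mulr_ge0 // ltW.
have Sload : \sum_(e <- t) reg_cost c lam e.2 * Num.max 1 (y e.2)
            * demand e.1 e.2 / lam / 10 <= (2 * lam + Psi) / 10.
  rewrite -mulr_suml ler_wpM2r // -mulr_suml ler_pdivrMr //.
  rewrite (sum_trace (fun i => reg_cost c lam i * Num.max 1 (y i)) pm).
  apply: (@le_trans _ _ (\sum_(i in X)
      (reg_cost c lam i + reg_cost c lam i * y i) * lam)).
    apply: ler_sum => i _; apply: ler_pM => //.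
    - by rewrite mulr_ge0 // le_max ler01.
    - exact: trace_load_ge0.
    - rewrite -[X in X + _]mulr1 -mulrDr ler_wpM2l // ge_max.
      by have := y0 i; move=> ?; apply/andP; split; lra.
  rewrite -mulr_suml ler_wpM2r ?(ltW lam0) // big_split /=.
  lra.
have Slog : \sum_(i in X) reg_cost c lam i * (ln_cap (y i) + ln m%:R)
    <= 2 * lam * l.
  apply: (@le_trans _ _ (\sum_(i in X) reg_cost c lam i * l)); last first.
    by rewrite -mulr_suml ler_wpM2r //; lra.
  apply: ler_sum => i _; rewrite ler_wpM2l // lerD2r.
  apply: (@le_trans _ _ (ln 2)).
    by rewrite /ln_cap ler_ln ?posrE ?lt_min ?y0 ?ge_min ?lexx ?orbT //=.
  exact: ln2_le1.
have ll : lam <= l * lam by rewrite ler_peMl // ltW.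
have A13 : A - A0 <= 13 * l * lam by lra.
have Psi66 : Psi <= 67 * l * lam by lra.
split.
- by lra.
- apply: (@le_trans _ _ Psi); last by lra.
  apply: ler_sum => i _; rewrite ler_wpM2r ?(ltW (y0 i)) //.
  by rewrite lerDl divr_ge0 // ltW.
- move=> i; have [ci|ci] := leP (c i) lam; last first.
    by rewrite h5 //; lra.
  (* As [reg_cost] is at least [lam / m], the potential caps [y i] at [67 * l * m], and only the
     logarithm of this cap enters the load. *)
  have k1 : lam / m%:R * y i <= Psi.
    rewrite /Psi (bigD1 i ci) /=; apply: ler_wpDr.
      by apply: sumr_ge0 => j _; rewrite mulr_ge0 // ltW.
    by rewrite ler_wpM2r ?(ltW (y0 i)) // lerDr.
  have k2 : y i <= 67 * l * m%:R.
    rewrite -(ler_pM2l (divr_gt0 lam0 mR)); apply: le_trans k1 _.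
    apply: le_trans Psi66 _.
    by rewrite le_eqVlt; apply/orP; left; apply/eqP; field; rewrite gt_eqF.
  have k3 : ln (y i) <= ln 67 + ln l + ln m%:R.
    have l0 : 0 < l by lra.
    by rewrite -!lnM ?posrE ?ler_ln ?posrE ?mulr_gt0.
  have k4 : ln l <= l by apply/ltW/ln_sublinear; lra.
  have k5 : ln 67 <= 66 :> R.
    rewrite (_ : 67 = 1 + 66); last by lra.
    by apply: le_ln1Dx; lra.
  have k6 : ln (y i) + ln m%:R <= 67 * l.
    have lE : ln m%:R = l - 1 :> R by rewrite /l; lra.
    lra.
  have l40 : 0 <= 40 * lam by rewrite mulr_ge0 // ltW.
  by have := ler_wpM2l l40 k6; have := h4 i; lra.
Qed.

End Phase.

Arguments phase_factor : clear implicits.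

(** * Offline solutions as traces, and the offline optimum *)

Section Optimum.
Context {R : realType} {F : facilities R}.
Local Notation m := (num_fac F).
Local Notation c := (@opening_cost R F).
Implicit Types (X : {set 'I_m}) (t : seq (client R m * 'I_m)).

Definition trace_cost X t : R :=
  \sum_(i in X) c i + trace_assign t
  + \big[Num.max/0]_(i < m) trace_load t i.

Lemma trace_load_le_max t i :
  trace_load t i <= \big[Num.max/0]_(i < m) trace_load t i.
Proof. exact: (@le_bigmax _ _ _ 0 (trace_load t)). Qed.

Lemma trace_max_ge0 t : 0 <= \big[Num.max/0]_(i < m) trace_load t i.
Proof. exact: bigmax_ge_id. Qed.

Lemma opening_sum_ge0 X : 0 <= \sum_(i in X) c i.
Proof. by apply: sumr_ge0 => i _; exact: opening_cost_ge0. Qed.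

Lemma trace_cost_ge0 X t : 0 <= trace_cost X t.
Proof.
have := opening_sum_ge0 X; have := trace_assign_ge0 t.
by have := trace_max_ge0 t; rewrite /trace_cost; lra.
Qed.

Lemma plan_trace_cost X t : all (fun e => e.2 \in X) t ->
  plan c (trace_cost X t) X t.
Proof.
have := opening_sum_ge0 X; have := trace_assign_ge0 t.
have := trace_max_ge0 t; rewrite /trace_cost => h1 h2 h3 tX.
split=> //; try lra.
by move=> i; have := trace_load_le_max t i; lra.
Qed.

Section Tuple.
Variables (n : nat) (sigma : n.-tuple (client R m)).
Implicit Types f : {ffun 'I_n -> 'I_m}.

Definition trace_of f := [seq (tnth sigma j, f j) | j <- enum 'I_n].

Lemma unzip1_trace_of f : unzip1 (trace_of f) = sigma.
Proof. by rewrite /unzip1 -map_comp; exact: map_tnth_enum. Qed.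

Lemma all_trace_of X f : all (fun e => e.2 \in X) (trace_of f) = feasible X f.
Proof.
rewrite all_map; apply/allP/forallP => [h j|h j _]; last exact: h.
by apply: (h j); rewrite mem_enum.
Qed.

Lemma cost_trace X f : cost sigma X f = trace_cost X (trace_of f).
Proof.
rewrite /cost /trace_cost /trace_assign big_map big_enum /=; congr (_ + _).
apply: eq_bigr => i _.
by rewrite /load /trace_load big_map /= big_enum_cond.
Qed.

Lemma opt_le_cost X f : feasible X f -> opt sigma <= cost sigma X f.
Proof.
move=> Xf; apply: ge_inf; last by exists X, f.
by exists 0 => _ [X' [f' [_ ->]]]; rewrite cost_trace trace_cost_ge0.
Qed.

Lemma opt_attained : exists X f, feasible X f /\ opt sigma = cost sigma X f.
Proof.
pose P (p : {set 'I_m} * {ffun 'I_n -> 'I_m}) := feasible p.1 p.2.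
pose p0 : {set 'I_m} * {ffun 'I_n -> 'I_m} :=
  (finset.setT, [ffun=> Ordinal (num_fac_gt0 F)]).
have P0 : P p0 by apply/forallP => j; rewrite inE.
case: (arg_minP (fun p => cost sigma p.1 p.2) P0) => -[X f] Xf minXf.
exists X, f; split=> //; apply/eqP; rewrite eq_le opt_le_cost //=.
apply: lb_le_inf; first by exists (cost sigma X f), X, f.
by move=> _ [X' [f' [Xf' ->]]]; exact: (minXf (X', f')).
Qed.

Lemma opt_le_trace X t : unzip1 t = sigma -> all (fun e => e.2 \in X) t ->
  opt sigma <= trace_cost X t.
Proof.
move=> ts tX.
have tn : size t == n by rewrite -(size_map fst) -/(unzip1 t) ts size_tuple.
pose tt := Tuple tn; pose f := [ffun j => (tnth tt j).2].
have st : sigma = map_tuple fst tt by apply/val_inj; rewrite /= -ts.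
have tf : trace_of f = t.
  rewrite -[RHS](map_tnth_enum tt); apply: eq_map => j.
  by rewrite st tnth_map ffunE -surjective_pairing.
by rewrite -tf -cost_trace opt_le_cost // -all_trace_of tf.
Qed.

Lemma opt_ge0 : 0 <= opt sigma.
Proof. by have [X [f [_ ->]]] := opt_attained; rewrite cost_trace trace_cost_ge0. Qed.

Lemma opt_plan lam : opt sigma <= lam ->
  exists X t, unzip1 t = sigma /\ plan c lam X t.
Proof.
have [X [f [Xf ->]]] := opt_attained; rewrite cost_trace => le_lam.
exists X, (trace_of f); split; first exact: unzip1_trace_of.
have [] := @plan_trace_cost X (trace_of f); first by rewrite all_trace_of.
move=> h1 h2 h3 h4; split=> // [||i]; apply: le_trans le_lam => //.
Qed.

End Tuple.

(** An optimal solution stays feasible and gets no dearer when the last client is dropped. *)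
Lemma opt_rcons (h : seq (client R m)) q :
  opt (in_tuple h) <= opt (in_tuple (rcons h q)).
Proof.
have [X [f [Xf ->]]] := opt_attained (in_tuple (rcons h q)).
have := Xf; rewrite -(all_trace_of (in_tuple (rcons h q))) cost_trace.
have := unzip1_trace_of (in_tuple (rcons h q)) f.
case/lastP: (trace_of _ f) => [/(congr1 size)|t e]; first by rewrite size_rcons.
rewrite /unzip1 map_rcons => /rcons_inj[th _].
rewrite all_rcons => /andP[_ tX].
apply: le_trans (opt_le_trace (sigma := in_tuple h) th tX) _.
rewrite /trace_cost -cats1 trace_assign_cat lerD //.
  by rewrite lerD2l lerDl trace_assign_ge0.
apply: le_bigmax2 => i _.
by rewrite trace_load_cat lerDl trace_load_ge0.
Qed.

End Optimum.

(** * The fractional algorithm over all phases *)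

Section Fractional.
Context {R : realType} {F : facilities R}.
Local Notation m := (num_fac F).
Local Notation c := (@opening_cost R F).
Local Notation history := (seq (client R m)).
Local Notation K := (phase_factor R m).

(* [alpha] and [frac_load] accumulate over all phases and only serve the
   analysis; [past s i] sums the final levels of [i] over the finished phases
   whose guess was at least [c i]. *)
Record state := State {
  guess : R;
  level : 'I_m -> R;
  serving : {set 'I_m};
  alpha : R;
  frac_load : 'I_m -> R;
  past : 'I_m -> R }.
Implicit Types (s : state) (h : history) (q : client R m).

(** A facility dearer than the guess cannot serve; its initial level 1/m is kept out, since its
    opening cost is not bounded by the guess. *)
Definition weight s i :=
  past s i + if (0 < guess s) && (c i <= guess s) then level s i else 0.

Definition update_guess h s :=
  if opt (in_tuple h) <= guess s then s
  else State (2 * opt (in_tuple h)) (fun=> m%:R^-1) finset.set0 (alpha s)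
         (frac_load s) (weight s).

(* While the guess is 0, no phase is running and all clients are left to the
   fallback, at cost 0. *)
Definition serve q s :=
  match pselect (exists p : {set 'I_m} * R * ('I_m -> R),
      0 < guess s /\ served c (guess s) (level s) q p.1.1 p.1.2 p.2) with
  | left ex => let: (T, al, y) := projT1 (cid ex) in
      State (guess s) y T (alpha s + al)
        (fun i => frac_load s i + if i \in T then demand q i else 0) (past s)
  | right _ => State (guess s) (level s) finset.set0 (alpha s) (frac_load s)
      (past s)
  end.

Fixpoint rev_state (r : history) : state :=
  if r is q :: r' then serve q (update_guess (rev r) (rev_state r'))
  else State 0 (fun=> m%:R^-1) finset.set0 0 (fun=> 0) (fun=> 0).

Definition state_of h := rev_state (rev h).

Lemma state_of_rcons h q :
  state_of (rcons h q) = serve q (update_guess (rcons h q) (state_of h)).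
Proof. by rewrite /state_of rev_rcons /= -rev_rcons revK. Qed.

(* [h] is the history already served; [s] may have a guess updated for the next
   client. *)
Record consistent h s : Prop := Consistent {
  guess_ge0 : 0 <= guess s;
  guess0 : guess s = 0 -> alpha s <= 0 /\ forall i, frac_load s i <= 0;
  current_phase : 0 < guess s -> exists A0 L0 pre suf,
    [/\ h = pre ++ suf,
        phase c (guess s) A0 L0 suf (level s) (alpha s) (frac_load s),
        A0 <= K * guess s & forall i, L0 i <= K * guess s];
  past_sum : \sum_i c i * past s i <= K * guess s;
  past_value : forall i, past s i = 0 \/ m%:R^-1 <= past s i }.

Lemma phase_factor_gt0 : 0 < K.
Proof.
apply: mulr_gt0; first by rewrite ltr0n.
by have := @ln_ge0 R m%:R; rewrite ler1n num_fac_gt0 => /(_ isT); lra.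
Qed.

Lemma num_fac_inv_gt0 : 0 < m%:R^-1 :> R.
Proof. by rewrite invr_gt0 ltr0n num_fac_gt0. Qed.

(** An optimal plan for the history is cut down to the clients of the current phase, where
    [phase_bounds] applies; the earlier phases add at most another [K * guess s]. *)
Lemma consistent_bounds h s : consistent h s -> opt (in_tuple h) <= guess s ->
  [/\ alpha s <= 2 * (K * guess s),
      \sum_i c i * weight s i <= 2 * (K * guess s),
      forall i, frac_load s i <= 2 * (K * guess s) &
      0 < guess s -> forall i, m%:R^-1 <= level s i].
Proof.
move=> cs /opt_plan[X [t [th pl]]].
have [g0 z cur ps pv] := cs.
have K0 := phase_factor_gt0.
have [gp|gn] := ltP 0 (guess s); last first.
  have g00 : guess s = 0 by apply/eqP; rewrite eq_le gn g0.
  have [a0 l0] := z g00.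
  rewrite g00 !mulr0; split=> //.
  move: ps; rewrite g00 mulr0; apply: le_trans; apply: ler_sum => i _.
  by rewrite /weight g00 ltxx addr0.
have [A0 [L0 [pre [suf [hE ph A0K L0K]]]]] := cur gp.
have tE : exists t1 t2, t = t1 ++ t2 /\ unzip1 t2 = suf.
  exists (take (size pre) t), (drop (size pre) t); rewrite cat_take_drop.
  by split=> //; rewrite /unzip1 map_drop -/(unzip1 t) th hE drop_size_cat.
have [t1 [t2 [tE' t2E]]] := tE.
have [_ pl2] : plan c (guess s) X t1 /\ plan c (guess s) X t2.
  by apply: plan_cat; rewrite -tE'.
have mp := num_fac_gt0 F; have cp := @opening_cost_ge0 R F.
have [b1 b2 b3] := phase_bounds mp cp gp ph t2E pl2.
have [b4 _ _ _ _] := phase_invariant mp cp gp ph t2E pl2.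
split=> //; first by lra.
- rewrite (eq_bigr (fun i => c i * past s i +
      (if c i <= guess s then c i * level s i else 0))); last first.
    by move=> i _; rewrite /weight gp mulrDr /=; case: ifP; rewrite ?mulr0.
  by rewrite big_split /= -big_mkcond /=; lra.
- by move=> i; have := b3 i; have := L0K i; lra.
Qed.

(** The gap between 0 and 1/m lets a positive weight absorb the additive 1/m of [average_below]. *)
Lemma weight_value h s i : consistent h s -> opt (in_tuple h) <= guess s ->
  weight s i = 0 \/ m%:R^-1 <= weight s i.
Proof.
move=> cs os; have [_ _ _ lv] := consistent_bounds cs os.
have := past_value cs i; rewrite /weight; case: ifP => [/andP[g0 _]|_]; last first.
  by rewrite addr0.
have := lv g0 i; have := num_fac_inv_gt0; move=> h1 h2 h3; right.
by case: h3 => [->|h3]; lra.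
Qed.

Lemma consistent_update h q s : consistent h s -> opt (in_tuple h) <= guess s ->
  guess s <= 2 * opt (in_tuple h) ->
  let s' := update_guess (rcons h q) s in
  [/\ consistent h s', opt (in_tuple (rcons h q)) <= guess s' &
      guess s' <= 2 * opt (in_tuple (rcons h q))].
Proof.
move=> cs os so /=; rewrite /update_guess.
have oo := opt_rcons h q.
have [le|lt] := leP (opt (in_tuple (rcons h q))) (guess s).
  by split=> //; lra.
have o0 : 0 <= opt (in_tuple h) := opt_ge0 _.
have g0 := guess_ge0 cs.
have K0 := phase_factor_gt0.
have [b1 b2 b3 b4] := consistent_bounds cs os.
(* The optimum has overtaken the old guess, so the new guess is more than twice the old one and the
   bounds of successive phases sum geometrically. *)
have Kg : 2 * (K * guess s) <= K * (2 * opt (in_tuple (rcons h q))).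
  by rewrite mulrCA ler_wpM2l ?(ltW K0) //; lra.
split=> /=; [|lra|lra].
split=> /=.
- lra.
- by move=> z; exfalso; lra.
- move=> _; exists (alpha s), (frac_load s), h, [::]; split.
  + by rewrite cats0.
  + exact: phase_nil.
  + exact: le_trans b1 Kg.
  + by move=> i; apply: le_trans (b3 i) Kg.
- exact: le_trans b2 Kg.
- by move=> i; exact: weight_value cs os.
Qed.

Lemma serve_guess q s : guess (serve q s) = guess s.
Proof. by rewrite /serve; case: pselect => // ex; case: cid => -[[]]. Qed.

Lemma serve_past q s : past (serve q s) = past s.
Proof. by rewrite /serve; case: pselect => // ex; case: cid => -[[]]. Qed.

(** With a positive guess [serve] never takes its idle branch: the facility given to [q] by an
    optimal plan is eligible, so [serve_exists] applies. *)
Lemma serve_gt0 h q s : consistent h s -> opt (in_tuple (rcons h q)) <= guess s ->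
  0 < guess s ->
  exists al, [/\ served c (guess s) (level s) q (serving (serve q s)) al
                   (level (serve q s)),
    alpha (serve q s) = alpha s + al &
    frac_load (serve q s) =
      (fun i => frac_load s i + if i \in serving (serve q s) then demand q i else 0)].
Proof.
move=> cs os g0; rewrite /serve; case: pselect => [ex|[]]; last first.
  have [X [t [th pl]]] := opt_plan os.
  have os' : opt (in_tuple h) <= guess s := le_trans (opt_rcons h q) os.
  have [_ _ _ lv] := consistent_bounds cs os'.
  have lv0 i : 0 < level s i := lt_le_trans num_fac_inv_gt0 (lv g0 i).
  have elig : exists i, eligible c (guess s) q i.
    move: th pl; case/lastP: t => [/(congr1 size)|t e]; first by rewrite size_rcons.
    rewrite /unzip1 map_rcons => /rcons_inj[_ <-]; rewrite -cats1.
    move=> /plan_cat[_ /(plan_seq1 (@opening_cost_ge0 R F))[_ ee _]].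
    by exists e.2.
  have [T [al [y' sv]]] :=
    serve_exists (num_fac_gt0 F) (@opening_cost_ge0 R F) g0 lv0 elig.
  by exists (T, al, y').
by case: cid => -[[T al] y'] [_ sv] /=; exists al.
Qed.

Lemma serve_eq0 q s : guess s = 0 ->
  serve q s = State (guess s) (level s) finset.set0 (alpha s) (frac_load s) (past s).
Proof.
by move=> g0; rewrite /serve; case: pselect => // -[p []]; rewrite g0 ltxx.
Qed.

Lemma consistent_serve h q s : consistent h s ->
  opt (in_tuple (rcons h q)) <= guess s -> consistent (rcons h q) (serve q s).
Proof.
move=> cs os; have [g0 z cur ps pv] := cs.
have [gp|gn] := ltP 0 (guess s); last first.
  have g00 : guess s = 0 by apply/eqP; rewrite eq_le gn g0.
  by rewrite serve_eq0 //; split=> //=; rewrite g00 ltxx.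
have [al [sv aE lE]] := serve_gt0 cs os gp.
split; rewrite ?serve_guess ?serve_past //.
  by move=> g00; move: gp; rewrite g00 ltxx.
move=> _; have [A0 [L0 [pre [suf [hE ph A0K L0K]]]]] := cur gp.
exists A0, L0, pre, (rcons suf q); split=> //; first by rewrite hE rcons_cat.
by rewrite aE lE; exact: phase_rcons ph sv.
Qed.

Lemma state_of_consistent h : [/\ consistent h (state_of h),
  opt (in_tuple h) <= guess (state_of h) &
  guess (state_of h) <= 2 * opt (in_tuple h)].
Proof.
elim/last_ind: h => [|h q [cs os so]].
  have o0 : opt (in_tuple ([::] : history)) = 0.
    apply/eqP; rewrite eq_le opt_ge0 andbT.
    have := @opt_le_trace _ F _ (in_tuple ([::] : history)) finset.set0 [::] erefl isT.
    rewrite /trace_cost /trace_assign big_set0 big_nil !add0r => /le_trans; apply.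
    by apply: bigmax_le => // i _; rewrite /trace_load big_nil.
  rewrite o0 mulr0; split=> //; split=> //=.
  - by rewrite ltxx.
  - by rewrite big1 ?mulr0 // => i _; rewrite mulr0.
  - by left.
have /= [cs' os' so'] := consistent_update q cs os so.
rewrite state_of_rcons serve_guess; split=> //.
exact: consistent_serve.
Qed.

(** The interface to the rounding. Levels restart when the guess changes, but they are moved into
    [past], so weights never decrease. *)
Lemma state_of_step h q (s := state_of h) (s' := state_of (rcons h q)) :
  [/\ guess s <= guess s',
      forall i, weight s i <= weight s' i,
      forall i, frac_load s' i =
        frac_load s i + if i \in serving s' then demand q i else 0,
      alpha s <= alpha s' /\
        forall i, i \in serving s' ->
          assign_cost q i <= alpha s' - alpha s /\ level s' i <= weight s' i &
      0 < guess s' -> 1 <= \sum_(i in serving s') Num.min 1 (level s' i)].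
Proof.
have [cs os so] := state_of_consistent h.
have /= [cs' os' so'] := consistent_update q cs os so.
rewrite {}/s' state_of_rcons -/s in cs cs' os os' so so' *.
set u := update_guess (rcons h q) s in cs' os' so' *.
have o0 : 0 <= opt (in_tuple h) := opt_ge0 _.
have oo := opt_rcons h q.
have [gu au lu] : [/\ guess s <= guess u, alpha u = alpha s & frac_load u = frac_load s].
  rewrite /u /update_guess; case: ifP => // /negbT; rewrite -ltNge => lt.
  split=> //=.
  by have := guess_ge0 cs; lra.
have wu i : weight s i <= weight u i.
  rewrite /u /update_guess; case: ifP => // _.
  by rewrite [leRHS]/weight /= lerDl; case: ifP => // _.
have past0 i : 0 <= past u i.
  by case: (past_value cs' i) => [->//|]; have := num_fac_inv_gt0; lra.
have [gp|gn] := ltP 0 (guess u); last first.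
  have g00 : guess u = 0 by apply/eqP; rewrite eq_le gn (guess_ge0 cs').
  rewrite serve_eq0 //; split=> /=.
  - exact: gu.
  - exact: wu.
  - by move=> i; rewrite inE addr0 lu.
  - by rewrite au; split=> // i; rewrite inE.
  - by rewrite g00 ltxx.
have [al [sv aE lE]] := serve_gt0 cs' os' gp.
rewrite serve_guess; split=> //.
- move=> i; apply: le_trans (wu i) _.
  rewrite /weight serve_guess serve_past lerD2l; case: ifP => // _.
  exact: served_mono sv i.
- by move=> i; rewrite lE lu.
- rewrite aE au; have al0 := served_ge0 sv; split=> [|i iT]; first by lra.
  have := served_assign sv iT => ai; split; first by lra.
  have /andP[ci _] := served_elig sv iT.
  by rewrite /weight serve_guess serve_past gp ci /= lerDr.
- by move=> _; exact: served_cover sv.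
Qed.

End Fractional.

(** * The uniform distribution on an initial segment of the naturals *)

Section UniformSeed.
Context {R : realType} (N : nat).

Definition uniform_seed : set nat -> \bar R :=
  msum (fun k => mscale (N.+1%:R^-1)%:nng \d_k) N.+1.

HB.instance Definition _ := Measure.on uniform_seed.

Lemma uniform_seed_setT : uniform_seed [set: nat]%classic = 1%E.
Proof.
rewrite /uniform_seed /msum /= (eq_bigr (fun=> (N.+1%:R^-1)%:E)); last first.
  by move=> k _; rewrite /mscale /= diracE in_setT mule1.
rewrite sumEFin sumr_const card_ord -(mulr_natr N.+1%:R^-1) mulVf ?pnatr_eq0 //.
Qed.

HB.instance Definition _ :=
  Measure_isProbability.Build _ _ _ uniform_seed uniform_seed_setT.

Lemma expectation_uniform_seed (f : nat -> R) : (forall k, 0 <= f k) ->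
  ('E_(uniform_seed)[f] = (\sum_(k < N.+1) f k / N.+1%:R)%:E)%E.
Proof.
move=> f0; rewrite unlock ge0_integral_measure_sum //=; last first.
  by move=> k _; rewrite lee_fin.
rewrite -sumEFin; apply: eq_bigr => k _.
rewrite ge0_integral_mscale //=; last by move=> k' _; rewrite lee_fin.
by rewrite integral_dirac // diracT mul1e -EFinM mulrC.
Qed.

End UniformSeed.

(** * Averages over a finite type *)

Section Average.
Context {R : realType} {T : finType}.

Definition average (f : T -> R) : R := \sum_w f w / #|T|%:R.

Lemma averageD f g : average (fun w => f w + g w) = average f + average g.
Proof. by rewrite -big_split /=; apply: eq_bigr => w _; rewrite mulrDl. Qed.

Lemma averageZ a f : average (fun w => a * f w) = a * average f.
Proof. by rewrite mulr_sumr; apply: eq_bigr => w _; rewrite mulrA. Qed.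

Lemma average_sum (I : finType) (g : I -> T -> R) :
  average (fun w => \sum_i g i w) = \sum_i average (g i).
Proof.
by rewrite exchange_big /=; apply: eq_bigr => w _; rewrite mulr_suml.
Qed.

Lemma average_cst a : (0 < #|T|)%N -> average (fun=> a) = a.
Proof.
move=> T0; rewrite /average sumr_const -[LHS](mulr_natr (a / _)) divfK //.
by rewrite pnatr_eq0 -lt0n.
Qed.

Lemma le_average f g : (forall w, f w <= g w) -> average f <= average g.
Proof. by move=> fg; apply: ler_sum => w _; rewrite ler_wpM2r // invr_ge0. Qed.

End Average.

(** * Independent uniform thresholds *)

Section Thresholds.
Context {R : realType} {m : nat}.
Hypothesis m_gt0 : (0 < m)%N.

(** The count is the minimum of [k] and the ceiling of [z]. The lower bound serves the failure
    probability, the upper one the opening costs. *)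
Lemma count_below k (z : R) : 0 <= z ->
  Num.min k%:R z <= \sum_(v < k) ((v%:R < z)%R%:R : R) <= Num.min k%:R (z + 1).
Proof.
move=> z0; elim: k => [|k /andP[IH1 IH2]].
  by rewrite big_ord0 !ge_min !le_min lexx /= addr_ge0.
rewrite big_ord_recr /= -natr1.
have [kz|zk] := ltP k%:R z.
  move: IH1; rewrite (_ : Num.min _ _ = k%:R); last exact/min_idPl/ltW.
  move: IH2; rewrite le_min => /andP[IH2 _] IH1.
  rewrite (_ : true%:R = 1 :> R) //.
  by rewrite ge_min le_min; apply/andP; split; [apply/orP; left|apply/andP; split]; lra.
rewrite addr0; move: IH1; rewrite (_ : Num.min _ _ = z); last exact/min_idPr.
move: IH2; rewrite le_min => /andP[IH2 IH3] IH1.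
by rewrite ge_min le_min; apply/andP; split; [apply/orP; right|apply/andP; split]; lra.
Qed.

Lemma card_thresholds : #|{ffun 'I_m -> 'I_m}|%:R = m%:R ^+ m :> R.
Proof. by rewrite card_ffun !card_ord natrX. Qed.

(** Independence of the coordinates of a uniformly drawn function. *)
Lemma average_prod (g : 'I_m -> 'I_m -> R) :
  average (fun w : {ffun 'I_m -> 'I_m} => \prod_i g i (w i))
  = \prod_i average (g i).
Proof.
rewrite /average bigA_distr_bigA; apply: eq_bigr => w _.
rewrite card_thresholds big_split /= prodr_const !card_ord.
by rewrite exprVn.
Qed.

Lemma average_below (i : 'I_m) (x : R) : 0 <= x ->
  average (fun w : {ffun 'I_m -> 'I_m} => ((w i)%:R < m%:R * x)%R%:R : R)
    <= x + m%:R^-1.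
Proof.
move=> x0; have mR : 0 < m%:R :> R by rewrite ltr0n.
pose g j (v : 'I_m) : R := if j == i then (v%:R < m%:R * x)%R%:R else 1.
have -> : average (fun w : {ffun 'I_m -> 'I_m} => ((w i)%:R < m%:R * x)%R%:R : R)
    = \prod_j average (g j).
  rewrite -average_prod; apply: eq_bigr => w _; congr (_ / _).
  rewrite (bigD1 i) //= big1 ?mulr1 /g ?eqxx // => j /negbTE ji.
  by rewrite ji.
rewrite (bigD1 i) //= big1 ?mulr1; last first.
  by move=> j /negbTE ji; rewrite /g ji average_cst // card_ord.
rewrite /average /g eqxx -mulr_suml card_ord ler_pdivrMr // mulrDl mulVf ?gt_eqF //.
have mx0 : 0 <= m%:R * x by rewrite mulr_ge0 // ltW.
have /andP[_] := count_below m mx0.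
by rewrite le_min [x * _]mulrC => /andP[_].
Qed.

(** By independence the average is a product over [T]. Its factor at [j] vanishes if [b * y j] is at
    least 1, and is otherwise at most [1 - b * y j]; both are below
    [expR (- (b * Num.min 1 (y j)))]. *)
Lemma average_none_below (T : {set 'I_m}) (y : 'I_m -> R) (b : R) : 1 <= b ->
  (forall i, i \in T -> 0 <= y i) ->
  1 <= \sum_(i in T) Num.min 1 (y i) ->
  average (fun w : {ffun 'I_m -> 'I_m} =>
    (~~ [exists i, (i \in T) && ((w i)%:R < m%:R * (b * y i))%R])%:R : R)
  <= expR (- b).
Proof.
move=> b1 y0 cover; have mR : 0 < m%:R :> R by rewrite ltr0n.
pose g j (v : 'I_m) : R := if j \in T then 1 - (v%:R < m%:R * (b * y j))%R%:R else 1.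
rewrite (_ : average _ = \prod_j average (g j)); last first.
  rewrite -average_prod; apply: eq_bigr => w _; congr (_ / _).
  case: existsP => [[j /andP[jT jw]]|none] /=.
    by rewrite (bigD1 j) //= /g jT jw subrr mul0r.
  rewrite big1 // => j _; rewrite /g; case: ifP => // jT.
  case E: (_ < _); last by rewrite subr0.
  by case: none; exists j; rewrite jT.
apply: (@le_trans _ _ (\prod_(i in T) expR (- (b * Num.min 1 (y i))))); last first.
  rewrite -expR_sum ler_expR sumrN -mulr_sumr lerN2 -[leLHS]mulr1.
  by rewrite ler_wpM2l //; lra.
rewrite [leRHS]big_mkcond /=; apply: ler_prod => j _.
rewrite /g; case: ifP => jT; last first.
  by rewrite average_cst ?card_ord // ler01 lexx.
have by0 : 0 <= b * y j by rewrite mulr_ge0 ?y0 //; lra.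
rewrite /average -mulr_suml card_ord; apply/andP; split.
  rewrite divr_ge0 // sumr_ge0 // => v _.
  by case: (_ < _); rewrite ?subrr ?subr0.
rewrite ler_pdivrMr // sumrB sumr_const card_ord.
have mx0 : 0 <= m%:R * (b * y j) by rewrite mulr_ge0 // ltW.
have /andP[h _] := count_below m mx0.
have e0 := expR_gt0 (- (b * Num.min 1 (y j))).
have [b1y|by1] := leP 1 (b * y j).
  move: h; rewrite (min_idPl _); last by rewrite ler_peMr // ltW.
  by move=> h; have := mulr_ge0 (ltW e0) (ltW mR); lra.
move: h; rewrite (min_idPr _); last by rewrite ler_piMr // ltW.
have e1 : 1 - b * y j <= expR (- (b * Num.min 1 (y j))).
  apply: le_trans (expR_ge1Dx _) _; rewrite ler_expR lerN2 ler_wpM2l //; first by lra.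
  by rewrite ge_min lexx orbT.
have := ler_wpM2r (ltW mR) e1; lra.
Qed.

End Thresholds.

(** * Randomized rounding *)

Section Rounding.
Context {R : realType} {F : facilities R}.
Local Notation m := (num_fac F).
Local Notation c := (@opening_cost R F).
Local Notation history := (seq (client R m)).
Local Notation K := (phase_factor R m).
Local Notation thresholds := {ffun 'I_m -> 'I_m}.
Implicit Types (h : history) (q : client R m) (w : thresholds).

Definition boost (k : nat) : R := 1 + 2 * ln k.+1%:R.

Definition triggered w h q i : bool :=
  let s := state_of (rcons h q) in
  (i \in serving s)
  && ((w i)%:R < m%:R * (boost (size h).+1 * level s i))%R.

Definition failed w h q : bool := ~~ [exists i, triggered w h q i].

Definition affordable h q i : bool :=
  let g := guess (state_of (rcons h q)) in
  [&& c i <= g, assign_cost q i <= g & demand q i <= g].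

Definition fallback h q : 'I_m :=
  odflt (Ordinal (num_fac_gt0 F)) [pick i | affordable h q i].

Definition choice w h q : 'I_m :=
  odflt (fallback h q) [pick i | triggered w h q i].

Fixpoint rev_trace w (r : history) : seq (client R m * 'I_m) :=
  if r is q :: r' then rcons (rev_trace w r') (q, choice w (rev r') q) else [::].

Definition online_trace w h := rev_trace w (rev h).

Fixpoint rev_penalty w (r : history) : R :=
  if r is q :: r' then
    rev_penalty w r'
    + guess (state_of (rcons (rev r') q)) * (failed w (rev r') q)%:R
  else 0.

Definition penalty w h := rev_penalty w (rev h).

Definition facilities_used w h : {set 'I_m} :=
  [set i | i \in unzip2 (online_trace w h)].

Lemma online_trace_rcons w h q :
  online_trace w (rcons h q) = rcons (online_trace w h) (q, choice w h q).
Proof. by rewrite /online_trace rev_rcons /= revK. Qed.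

Lemma penalty_rcons w h q : penalty w (rcons h q) =
  penalty w h + guess (state_of (rcons h q)) * (failed w h q)%:R.
Proof. by rewrite /penalty rev_rcons /= revK. Qed.

Lemma facilities_used_rcons w h q :
  facilities_used w (rcons h q) = (choice w h q |: facilities_used w h)%SET.
Proof.
apply/setP => i; rewrite !inE online_trace_rcons /unzip2 map_rcons.
by rewrite mem_rcons inE.
Qed.

Lemma facilities_used_mono w h q :
  facilities_used w h \subset facilities_used w (rcons h q).
Proof. by rewrite facilities_used_rcons finset.subsetUr. Qed.

Lemma choice_used w h q : choice w h q \in facilities_used w (rcons h q).
Proof. by rewrite facilities_used_rcons finset.setU11. Qed.

Definition threshold_alg w : online_alg F :=
  OnlineAlg (facilities_used_mono w) (choice_used w).

Lemma fallback_affordable h q : affordable h q (fallback h q).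
Proof.
rewrite /fallback; case: pickP => [i //|none].
have [_ os _] := state_of_consistent (rcons h q).
have [X [t [th pl]]] := opt_plan os.
move: th pl; case/lastP: t => [/(congr1 size)|t e]; first by rewrite size_rcons.
rewrite /unzip1 map_rcons => /rcons_inj[_ eq]; rewrite -(cats1 t).
move=> /plan_cat[_ /(plan_seq1 (@opening_cost_ge0 R F))[_ /andP[ce de] ae]].
rewrite eq in de ae.
by have := none e.2; rewrite /affordable ce de ae.
Qed.

Lemma choiceP w h q : if failed w h q then affordable h q (choice w h q)
  else triggered w h q (choice w h q).
Proof.
rewrite /failed /choice; case: pickP => [i ti|none] /=.
  by rewrite (introT existsP) //; exists i.
rewrite (introF existsP) /=; first exact: fallback_affordable.
by case=> i; rewrite none.
Qed.

Lemma boost_ge1 k : 1 <= boost k.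
Proof. by rewrite lerDl mulr_ge0 // ln_ge0 // ler1n. Qed.

Lemma boost_mono k : boost k <= boost k.+1.
Proof. by rewrite lerD2l ler_wpM2l // ler_ln ?posrE ?ltr0n // ler_nat. Qed.

Lemma expR_boost k : expR (- boost k) <= (k.+1%:R ^+ 2)^-1.
Proof.
have k0 : 0 < k.+1%:R :> R by rewrite ltr0n.
have -> : (k.+1%:R ^+ 2)^-1 = expR (- (2 * ln k.+1%:R)) :> R.
  by rewrite expRN mulr_natl -lnXn // lnK // posrE exprn_gt0.
by rewrite ler_expR /boost; lra.
Qed.

(** Boosts and weights only grow, so this set contains every facility triggered so far. Hence the
    opening cost depends on the final weights alone, and one threshold per facility suffices. *)
Definition below w h : {set 'I_m} :=
  [set i | ((w i)%:R < m%:R * (boost (size h) * weight (state_of h) i))%R].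

Lemma weight_ge0 h i : 0 <= weight (state_of h) i.
Proof.
have [cs os _] := state_of_consistent h.
by case: (weight_value i cs os) => [->//|]; have := @num_fac_inv_gt0 R F; lra.
Qed.

Lemma scaled_weight_step h q i :
  m%:R * (boost (size h) * weight (state_of h) i) <=
  m%:R * (boost (size h).+1 * weight (state_of (rcons h q)) i).
Proof.
have [_ /(_ i) wi _ _ _] := state_of_step h q.
rewrite ler_wpM2l // ler_pM ?weight_ge0 ?boost_mono //.
by have := boost_ge1 (size h); lra.
Qed.

Lemma guess_state_ge0 h : 0 <= guess (state_of h).
Proof. by have [[]] := state_of_consistent h. Qed.

(** [B] collects the facilities chosen by the fallback. Each failure adds at most the current guess
    to opening cost, assignment cost and load alike, which is what [penalty] records. *)
Lemma online_trace_bounds w h :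
  [/\ exists2 B : {set 'I_m},
        facilities_used w h \subset below w h :|: B &
        \sum_(i in B) c i <= penalty w h,
      trace_assign (online_trace w h) <= alpha (state_of h) + penalty w h,
      forall i, trace_load (online_trace w h) i <=
        frac_load (state_of h) i + penalty w h &
      0 <= penalty w h].
Proof.
elim/last_ind: h => [|h q [[B hB cB] ha hl hp]].
  rewrite /penalty /= /online_trace /= /trace_assign big_nil; split; rewrite ?addr0 //.
    exists finset.set0; last by rewrite big_set0.
    by apply/fintype.subsetP => i; rewrite !inE.
  by move=> i; rewrite /trace_load big_nil.
have [sg sw sl [sa sT] _] := state_of_step h q.
have g0 := guess_state_ge0 (rcons h q).
have bm : below w h \subset below w (rcons h q).
  apply/fintype.subsetP => i; rewrite !inE size_rcons => /lt_le_trans; apply.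
  exact: scaled_weight_step.
rewrite penalty_rcons online_trace_rcons -(cats1 (online_trace w h)) trace_assign_cat.
rewrite trace_assign_seq1 /=.
have := choiceP w h q; set x := choice w h q.
case: (failed w h q) => [/and3P[cx ax dx]|/andP[xT wx]]; rewrite ?mulr1 ?mulr0 ?addr0.
- split; last by lra.
  + exists (x |: B)%SET.
      rewrite facilities_used_rcons -/x; apply/fintype.subsetP => i.
      rewrite !finset.in_setU !finset.in_set1 => /orP[->|iu]; first by rewrite orbT.
      have := fintype.subsetP hB i iu; rewrite finset.in_setU => /orP[ib|->].
        by rewrite (fintype.subsetP bm _ ib).
      by rewrite !orbT.
    have [xB|xB] := boolP (x \in B).
      by rewrite (finset.setUidPr _) ?finset.sub1set //; lra.
    by rewrite big_setU1 //=; lra.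
  + by lra.
  + move=> i; rewrite trace_load_cat trace_load_seq1 sl /=.
    have := hl i; have := demand_ge0 q i.
    have [<-|_] := eqVneq x i; case: ifP; lra.
- have [axa lw] := sT x xT.
  split=> //.
  + exists B => //; rewrite facilities_used_rcons -/x; apply/fintype.subsetP => i.
    rewrite !finset.in_setU !finset.in_set1 => /orP[/eqP->|iu]; last first.
      have := fintype.subsetP hB i iu; rewrite finset.in_setU => /orP[ib|->].
        by rewrite (fintype.subsetP bm _ ib).
      by rewrite !orbT.
    rewrite inE size_rcons; apply/orP; left; apply: lt_le_trans wx _.
    rewrite ler_wpM2l // ler_wpM2l //.
    by have := boost_ge1 (size h).+1; lra.
  + by lra.
  + move=> i; rewrite trace_load_cat trace_load_seq1 sl /=.
    have := hl i; have := demand_ge0 q i.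
    by have [<-|_] := eqVneq x i; rewrite ?xT; last case: ifP; lra.
Qed.

(** The 4 is 2 for the prices plus 2 for the loads; the penalty enters once in each of the three
    cost components. *)
Lemma online_trace_cost w h :
  trace_cost (facilities_used w h) (online_trace w h) <=
  \sum_i c i * (i \in below w h)%:R + 4 * (K * guess (state_of h))
  + 3 * penalty w h.
Proof.
have [[B hB cB] ha hl hp] := online_trace_bounds w h.
have [cs os _] := state_of_consistent h.
have [b1 _ b3 _] := consistent_bounds cs os.
have c0 := @opening_cost_ge0 R F.
have K0 : 0 <= K * guess (state_of h).
  by rewrite mulr_ge0 ?guess_state_ge0 // ltW // phase_factor_gt0.
have open : \sum_(i in facilities_used w h) c i <=
    \sum_i c i * (i \in below w h)%:R + penalty w h.
  apply: le_trans (lerD (lexx _) cB).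
  rewrite [leLHS]big_mkcond [in leRHS](big_mkcond (mem B)) -big_split /=.
  apply: ler_sum => i _; case: ifP => [iu|_].
    have := fintype.subsetP hB i iu; rewrite finset.in_setU => /orP[->|->].
      by rewrite mulr1 lerDl; case: ifP.
    by rewrite lerDr mulr_ge0.
  by rewrite addr_ge0 ?mulr_ge0 //; case: ifP.
have mk : \big[Num.max/0]_(i < m) trace_load (online_trace w h) i <=
    2 * (K * guess (state_of h)) + penalty w h.
  apply: bigmax_le => [|i _]; first by lra.
  by have := hl i; have := b3 i; lra.
rewrite /trace_cost; lra.
Qed.

Lemma average_below_cost h :
  average (fun w => \sum_i c i * (i \in below w h)%:R) <=
  4 * boost (size h) * (K * guess (state_of h)).
Proof.
have [cs os _] := state_of_consistent h.
have [_ b2 _ _] := consistent_bounds cs os.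
have B1 := boost_ge1 (size h).
rewrite average_sum.
apply: (@le_trans _ _ (\sum_i 2 * boost (size h) * (c i * weight (state_of h) i))).
  apply: ler_sum => i _; rewrite averageZ.
  rewrite [leRHS]mulrCA ler_wpM2l ?opening_cost_ge0 //.
  have w0 := weight_ge0 h i.
  have x0 : 0 <= boost (size h) * weight (state_of h) i.
    by rewrite mulr_ge0 //; lra.
  have -> : average (fun w => (i \in below w h)%:R) =
      average (fun w : thresholds =>
        ((w i)%:R < m%:R * (boost (size h) * weight (state_of h) i))%R%:R) :> R.
    by apply: eq_bigr => w _; rewrite /below inE.
  have [z|wm] := weight_value i cs os.
    by rewrite z !mulr0 /average big1 // => w _; rewrite ltrn0 mul0r.
  by apply: le_trans (average_below (num_fac_gt0 F) i x0) _; nra.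
rewrite -mulr_sumr; have g0 := guess_state_ge0 h.
have := ler_wpM2l (_ : 0 <= 2 * boost (size h)) b2.
by move=> /(_ ltac:(lra)); lra.
Qed.

(** The [k]-th client fails with probability at most [(k + 1)^-2], which is below the telescoping
    difference of the inverses of [k] and [k + 1]; guesses are nondecreasing. *)
Lemma average_penalty h :
  average (fun w => penalty w h) <=
  guess (state_of h) * (1 - (size h).+1%:R^-1).
Proof.
elim/last_ind: h => [|h q IH].
  by rewrite /penalty /= invr1 subrr mulr0 /average big1 // => w _; rewrite mul0r.
rewrite (_ : (fun w => _) = (fun w => penalty w h +
    guess (state_of (rcons h q)) * (failed w h q)%:R)); last first.
  by apply/funext => w; rewrite penalty_rcons.
rewrite averageD averageZ size_rcons.
have [sg sw sl [sa sT] cov] := state_of_step h q.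
have g0 := guess_state_ge0 h.
set g := guess (state_of (rcons h q)) in sg cov *.
set k := (size h).+1.
have k0 : 0 < k%:R :> R by rewrite ltr0n.
have k1 : 1 <= k%:R :> R by rewrite ler1n.
have kS : k.+1%:R = k%:R + 1 :> R by rewrite natr1.
have IH' : average (fun w => penalty w h) <= g * (1 - k%:R^-1).
  apply: le_trans IH _; rewrite ler_wpM2r // subr_ge0.
  by rewrite invf_le1.
have [gp|gn] := ltP 0 g; last first.
  have g00 : g = 0 by apply/eqP; rewrite eq_le gn (le_trans g0 sg).
  by move: IH'; rewrite g00 !mul0r addr0.
have fl : average (fun w => (failed w h q)%:R : R) <= k%:R^-1 - k.+1%:R^-1.
  apply: (@le_trans _ _ (expR (- boost k))).
    apply: (average_none_below (num_fac_gt0 F) (boost_ge1 k) _ (cov gp)) => i _.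
    have [cs os _] := state_of_consistent (rcons h q).
    have [_ _ _ lv] := consistent_bounds cs os.
    by apply: le_trans (lv gp i); apply/ltW/num_fac_inv_gt0.
  apply: le_trans (expR_boost k) _.
  rewrite kS (_ : k%:R^-1 - (k%:R + 1)^-1 = (k%:R * (k%:R + 1))^-1); last first.
    by field; rewrite !gt_eqF //; lra.
  have kS0 : 0 < k%:R + 1 :> R by lra.
  rewrite lef_pV2 ?posrE ?exprn_gt0 ?mulr_gt0 // expr2 ler_wpM2r ?(ltW kS0) //.
  by lra.
by apply: le_trans (lerD IH' (ler_wpM2l (ltW gp) fl)) _; rewrite -mulrDr addrA subrK.
Qed.

Lemma average_online_cost h :
  average (fun w => trace_cost (facilities_used w h) (online_trace w h)) <=
  22 * (K * boost (size h)) * opt (in_tuple h).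
Proof.
apply: le_trans (le_average (fun w => online_trace_cost w h)) _.
have T0 : (0 < #|thresholds|)%N.
  by rewrite card_ffun !card_ord expn_gt0 num_fac_gt0.
rewrite !averageD average_cst // averageZ.
(* The summands are at most 4, 4 and 3 times [b * (K * g)], and the guess is at most twice the
   optimum: this gives 22. *)
have bounds := lerD (lerD (average_below_cost h) (lexx (4 * (K * guess (state_of h)))))
  (ler_wpM2l (ler0n _ 3) (average_penalty h)).
apply: le_trans bounds _.
have [cs os so] := state_of_consistent h.
have g0 := guess_state_ge0 h.
have B1 := boost_ge1 (size h).
have K1 : 1 <= K.
  have : 0 <= ln m%:R :> R by rewrite ln_ge0 // ler1n num_fac_gt0.
  by rewrite /phase_factor; lra.
set g := guess _ in os so g0 *; set b := boost _ in B1 *.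
have : 0 <= (size h).+1%:R^-1 :> R by rewrite invr_ge0.
set v := _%:R^-1 => v0; have gv : g * (1 - v) <= g by rewrite ler_piMr //; lra.
have Kg : g <= K * g by rewrite ler_peMl.
have bKg : K * g <= b * (K * g) by rewrite ler_peMl //; lra.
have o2 : b * (K * g) <= b * (K * (2 * opt (in_tuple h))).
  by rewrite ler_wpM2l ?ler_wpM2l //; lra.
lra.
Qed.

End Rounding.

(** * The randomized algorithm and its ratio *)

Section Algorithm.
Context {R : realType}.

Definition threshold_of_nat m (m_gt0 : (0 < m)%N) (k : nat) :
    {ffun 'I_m -> 'I_m} :=
  nth [ffun=> Ordinal m_gt0] (enum {: {ffun 'I_m -> 'I_m}}) k.

(** [uniform_seed N] has [N.+1] atoms, hence the predecessor. Measurability is trivial because every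
    set of naturals is measurable. *)
Definition algorithm (F : facilities R) : rand_online_alg F :=
  @RandOnlineAlg R F _ nat
    (uniform_seed #|{: {ffun 'I_(num_fac F) -> 'I_(num_fac F)}}|.-1)
    (fun k => threshold_alg (threshold_of_nat (num_fac_gt0 F) k))
    (fun _ _ => I) (fun _ _ _ => I).

Lemma online_trace_map (F : facilities R) w (h : seq (client R (num_fac F))) q0 :
  online_trace w h = [seq (nth q0 h j, choice w (take j h) (nth q0 h j)) |
                      j <- iota 0 (size h)].
Proof.
elim/last_ind: h => // h q IH.
rewrite online_trace_rcons IH size_rcons -addn1 iotaD map_cat cats1 /= add0n.
rewrite nth_rcons ltnn eqxx; have -> : take (size h) (rcons h q) = h.
  by rewrite -cats1 take_size_cat.
congr rcons.
apply/eq_in_map => j; rewrite mem_iota add0n => /andP[_ jh].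
by rewrite nth_rcons jh -cats1 takel_cat // ltnW.
Qed.

Lemma online_cost_trace (F : facilities R) w n
    (sigma : n.-tuple (client R (num_fac F))) :
  online_cost (threshold_alg w) sigma =
  trace_cost (facilities_used w sigma) (online_trace w sigma).
Proof.
rewrite /online_cost cost_trace; congr trace_cost.
(* The first client serves as default value for [nth], so the empty sequence is treated apart. *)
case: n sigma => [|n] sigma.
  by rewrite (tuple0 sigma) /trace_of (size0nil (size_enum_ord 0)).
rewrite (online_trace_map w sigma (tnth sigma ord0)) size_tuple -val_enum_ord -map_comp.
by apply: eq_map => j; rewrite ffunE /= -tnth_nth.
Qed.

Lemma sum_threshold_of_nat m (m_gt0 : (0 < m)%N) (f : {ffun 'I_m -> 'I_m} -> R) :
  \sum_(k < #|{: {ffun 'I_m -> 'I_m}}|.-1.+1)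
     f (threshold_of_nat m_gt0 k) / #|{: {ffun 'I_m -> 'I_m}}|.-1.+1%:R
  = average f.
Proof.
have T0 : (0 < #|{: {ffun 'I_m -> 'I_m}}|)%N.
  by rewrite card_ffun !card_ord expn_gt0 m_gt0.
rewrite prednK // /average -[RHS]big_enum /=.
rewrite (big_nth [ffun=> Ordinal m_gt0]) big_mkord -cardT.
by [].
Qed.

Lemma expected_cost_algorithm (F : facilities R) n
    (sigma : n.-tuple (client R (num_fac F))) :
  (expected_cost (algorithm F) sigma <=
   (22 * (phase_factor R (num_fac F) * boost n) * opt sigma)%:E)%E.
Proof.
rewrite /expected_cost /algorithm /=.
rewrite expectation_uniform_seed; last first.
  by move=> k; rewrite online_cost_trace trace_cost_ge0.
rewrite (sum_threshold_of_nat (num_fac_gt0 F)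
  (fun w => online_cost (threshold_alg w) sigma)) lee_fin.
case: sigma => h hn; have hE := eqP hn; case: _ / hE hn => hn.
rewrite (_ : Tuple hn = in_tuple h); last exact: val_inj.
apply: le_trans (average_online_cost h).
by apply: le_average => w; rewrite online_cost_trace.
Qed.

Lemma phase_factor_log_ge1 m : (0 < m)%N ->
  phase_factor R m <= 5360 * log_ge1 R m.
Proof.
move=> m0; rewrite /phase_factor.
have l1 : 1 <= log_ge1 R m by rewrite le_max lexx.
have l2 : ln m%:R <= log_ge1 R m by rewrite le_max lexx orbT.
by lra.
Qed.

(** From [n + 1 <= 2 * n] for positive [n], the boost is at most [1 + 2 * (ln n + 1)], hence 3 + 2
    logarithms. *)
Lemma boost_log_ge1 m n : (0 < m)%N -> boost n <= 5 * log_ge1 R (m * n).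
Proof.
move=> m0; rewrite /boost.
have l1 : 1 <= log_ge1 R (m * n) by rewrite le_max lexx.
case: n l1 => [|n] l1; first by rewrite ln1 mulr0 addr0; lra.
have l2 : ln (m * n.+1)%:R <= log_ge1 R (m * n.+1) by rewrite le_max lexx orbT.
have l3 : ln n.+1%:R <= ln (m * n.+1)%:R :> R.
  by rewrite ler_ln ?posrE ?ltr0n ?muln_gt0 ?m0 // ler_nat leq_pmull.
have l4 : ln n.+2%:R <= ln n.+1%:R + ln 2 :> R.
  rewrite -lnM ?posrE ?ltr0n // -natrM ler_ln ?posrE ?ltr0n ?muln_gt0 //.
  by rewrite ler_nat muln2 -addnn addSn addnS !ltnS leq_addr.
have l5 := @ln2_le1 R.
lra.
Qed.

End Algorithm.

Theorem theorem3p12 (R : realType) :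
  exists C : R, 0 < C /\
  exists A : forall F : facilities R, rand_online_alg F,
    competitive A (fun m n : nat => C * log_ge1 R m ^+ 2 * log_ge1 R (m * n)%N).
Proof.
exists (22 * (5360 * 5)); split; first by rewrite !mulr_gt0 ?ltr0n.
exists (@algorithm R) => F n sigma.
apply: le_trans (expected_cost_algorithm sigma) _.
rewrite lee_fin ler_wpM2r ?opt_ge0 //.
have m0 := num_fac_gt0 F.
have k1 := @phase_factor_log_ge1 R _ m0.
have b1 := @boost_log_ge1 R _ n m0.
set a := log_ge1 R (num_fac F) in k1 *; set b := log_ge1 R _ in b1 *.
have a1 : 1 <= a by rewrite le_max lexx.
have b0 : 1 <= b by rewrite le_max lexx.
have kb : phase_factor R (num_fac F) * boost n <= (5360 * a) * (5 * b).
  apply: ler_pM => //; first exact/ltW/phase_factor_gt0.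
  by have := @boost_ge1 R n; lra.
(* The bound obtained so far has a single factor [a]; as [1 <= a], it lies below the stated
   ratio. *)
have ab : a * b <= a ^+ 2 * b.
  by rewrite ler_wpM2r ?expr2 ?ler_peMr //; lra.
lra.
Qed.
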